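(* Let $M$ be a contact $CR$-submanifold of a Sasakian statistical manifold $(\bar M,\bar\nabla,\bar g,\phi,\xi)$, with invariant distribution $D$ and anti-invariant distribution $D^\perp$. Then $D^\perp$ is integrable if and only if \[ A_{\phi Y}X-A_{\phi X}Y=g(Y,\xi)X-g(X,\xi)Y \] for all $X,Y\in\Gamma(D^\perp)$.
   Context: A statistical manifold $(\bar M,\bar\nabla,\bar g)$ is a smooth Riemannian manifold $(\bar M,\bar g)$ with a torsion-free affine connection $\bar\nabla$ such that $(\bar\nabla_X\bar g)(Y,Z)=(\bar\nabla_Y\bar g)(X,Z)$. The dual connection $\bar\nabla^*$ is defined by $X\bar g(Y,Z)=\bar g(\bar\nabla_XY,Z)+\bar g(Y,\bar\nabla^*_XZ)$. Let $\hat{\bar\nabla}$ be the Levi-Civita connection of $\bar g$ and $K(X,Y)=\bar\nabla_XY-\hat{\bar\nabla}_XY$. An almost contact metric structure on an odd-dimensional $(\bar M,\bar g)$ consists of a $(1,1)$-tensor $\phi$, a unit vector field $\xi$ and a 1-form $\eta$ with $\phi^2X=-X+\eta(X)\xi$, $\bar g(X,\xi)=\eta(X)$, $\bar g(\phi X,\phi Y)=\bar g(X,Y)-\eta(X)\eta(Y)$ (so $\phi\xi=0$, $\eta\circ\phi=0$, $\bar g(\phi X,Y)=-\bar g(X,\phi Y)$). A Sasakian statistical manifold $(\bar M,\bar\nabla,\bar g,\phi,\xi)$ is a statistical manifold with an almost contact metric structure such that $\hat{\bar\nabla}_X\xi=\phi X$, $(\hat{\bar\nabla}_X\phi)Y=\bar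 g(Y,\xi)X-\bar g(Y,X)\xi$ and $K(X,\phi Y)+\phi K(X,Y)=0$. Consequently $\bar\nabla_X\phi Y-\phi\bar\nabla^*_XY=\bar g(Y,\xi)X-\bar g(Y,X)\xi$ and $\bar\nabla_X\xi=\phi X+\bar g(\bar\nabla_X\xi,\xi)\xi$, and the same identities hold with $\bar\nabla$ and $\bar\nabla^*$ interchanged. For a submanifold $M$ with induced metric $g$ ($g$ also denotes $\bar g$ on normal vectors), $X,Y\in\Gamma(TM)$ and $V\in\Gamma(T^\perp M)$, split into tangential and normal parts: $\bar\nabla_XY=\nabla_XY+h(X,Y)$, $\bar\nabla^*_XY=\nabla^*_XY+h^*(X,Y)$, $\bar\nabla_XV=-A_VX+\nabla^\perp_XV$, $\bar\nabla^*_XV=-A^*_VX+\nabla^{*\perp}_XV$. One has $g(A_VX,Y)=g(h^*(X,Y),V)$ and $g(A^*_VX,Y)=g(h(X,Y),V)$. $M$ is a contact $CR$-submanifold if $TM=D\oplus D^\perp$ for a differentiable distribution $D$ with $\xi\in\Gamma(D)$, $\phi(D_x)\subseteq D_x$, and with orthogonal complement $D^\perp$ satisfying $\phi(D^\perp_x)\subseteq T^\perp_xM$ for all $x\in M$. *)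

(* Defs.v *)
From HB Require Import structures.
From mathcomp Require Import all_boot all_order all_algebra.
From mathcomp Require Import all_classical all_reals all_analysis.

Set Implicit Arguments.
Unset Strict Implicit.
Unset Printing Implicit Defensive.

Import Order.TTheory GRing.Theory Num.Theory.
Import numFieldNormedType.Exports.

Local Open Scope classical_set_scope.
Local Open Scope ring_scope.

Section SmoothMaps.
Context {R : realType} {n : nat} {W : normedModType R}.

Fixpoint iter_partial (f : 'rV[R]_n -> W) (s : seq 'I_n) : 'rV[R]_n -> W :=
  if s is i :: s' then fun x => 'D_(delta_mx 0 i) (iter_partial f s') x else f.

(* On an open set this is equivalent to the existence and continuity of all the
   iterated partial derivatives. *)
Definition smooth_at (x : 'rV[R]_n) (f : 'rV[R]_n -> W) : Prop :=
  \forall y \near x, forall s : seq 'I_n, differentiable (iter_partial f s) y.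

End SmoothMaps.

(* The two maps are total; outside [chart_dom] and its image their values are
   irrelevant. *)
Record chart (R : realType) (n : nat) (T : topologicalType) := Chart {
  chart_dom : set T;
  chart_fun :> T -> 'rV[R]_n;
  chart_inv : 'rV[R]_n -> T;
  chart_dom_open : open chart_dom;
  chart_codom_open : open (chart_fun @` chart_dom);
  chart_funK : forall q, chart_dom q -> chart_inv (chart_fun q) = q;
  chart_fun_cont : forall q, chart_dom q -> {for q, continuous chart_fun};
  chart_inv_cont : forall q, chart_dom q ->
    {for chart_fun q, continuous chart_inv}
}.

(* The atlas is indexed by the points: [chart_at p] is a preferred chart around
   [p].  A tangent vector at [p] is represented by its components in
   [chart_at p], so that every tangent space is ['rV[R]_n]; the components of
   one vector in two charts are related by [chart_change] below. *)
Record manifold (R : realType) (n : nat) := Manifold {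
  manifold_space :> topologicalType;
  manifold_hausdorff : hausdorff_space manifold_space;
  manifold_second_countable : @second_countable manifold_space;
  chart_at : manifold_space -> chart R n manifold_space;
  mem_chart_at : forall p, chart_dom (chart_at p) p;
  transition_smooth : forall a b q,
    chart_dom (chart_at a) q -> chart_dom (chart_at b) q ->
    smooth_at (chart_at a q) (chart_at b \o chart_inv (chart_at a))
}.

Section Manifolds.
Context {R : realType} {n : nat} {M : manifold R n}.
Implicit Types (p q : M) (X Y : M -> 'rV[R]_n).

(* From components in [chart_at a] to components in [chart_at b], for tangent
   vectors at [q]. *)
Definition chart_change (a b q : M) : 'rV[R]_n -> 'rV[R]_n :=
  'd (chart_at b \o chart_inv (chart_at a)) (chart_at a q).

Definition smooth_fun_at (h : M -> R) p : Prop :=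
  smooth_at (chart_at p p) (h \o chart_inv (chart_at p)).

Definition fun_deriv (h : M -> R) p (v : 'rV[R]_n) : R :=
  'd (h \o chart_inv (chart_at p)) (chart_at p p) v.

(* The [k]-th coordinate vector field of [chart_at a], defined on its domain. *)
Definition coord_field (a : M) (k : 'I_n) : M -> 'rV[R]_n :=
  fun q => chart_change a q q (delta_mx 0 k).

End Manifolds.

Section MapsBetweenManifolds.
Context {R : realType} {m n : nat} {M : manifold R m} {N : manifold R n}.
Implicit Types (f : M -> N) (p : M).

Definition local_map f p : 'rV[R]_m -> 'rV[R]_n :=
  chart_at (f p) \o f \o chart_inv (chart_at p).

Definition smooth_map f : Prop :=
  forall p, {for p, continuous f} /\ smooth_at (chart_at p p) (local_map f p).

Definition tangent_map f p : 'rV[R]_m -> 'rV[R]_n :=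
  'd (local_map f p) (chart_at p p).

Definition submanifold f : Prop :=
  [/\ smooth_map f, injective f & forall p, injective (tangent_map f p)].

(* For a vector field [V] along [f], i.e. [V q] tangent to [N] at [f q]:
   the components of [V] in the fixed chart [chart_at (f p)], read in
   [chart_at p]. *)
Definition local_field f (V : M -> 'rV[R]_n) p : 'rV[R]_m -> 'rV[R]_n :=
  (fun q => chart_change (f q) (f p) (f q) (V q)) \o chart_inv (chart_at p).

End MapsBetweenManifolds.

Section VectorFields.
Context {R : realType} {n : nat} {M : manifold R n}.
Implicit Types (p : M) (X Y : M -> 'rV[R]_n).

Definition smooth_field_at X p : Prop :=
  smooth_at (chart_at p p) (local_field (@id M) X p).

Definition smooth_field X : Prop := forall p, smooth_field_at X p.

Definition lie_bracket X Y : M -> 'rV[R]_n := fun p =>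
  'd (local_field (@id M) Y p) (chart_at p p) (X p)
  - 'd (local_field (@id M) X p) (chart_at p p) (Y p).

End VectorFields.

(* [cov p v Y] is the covariant derivative at [p] in the direction [v] of a
   vector field [Y] that need only be smooth near [p].  Locality in [Y] follows
   from [covZ], applied to a function vanishing near [p] and equal to 1
   elsewhere. *)
Record connection (R : realType) (n : nat) (M : manifold R n) := Connection {
  cov :> forall p : M, 'rV[R]_n -> (M -> 'rV[R]_n) -> 'rV[R]_n;
  cov_linear : forall p (c : R) v w Y, smooth_field_at Y p ->
    cov p (c *: v + w) Y = c *: cov p v Y + cov p w Y;
  covD : forall p v Y Z, smooth_field_at Y p -> smooth_field_at Z p ->
    cov p v (fun q => Y q + Z q) = cov p v Y + cov p v Z;
  covZ : forall p v (h : M -> R) Y, smooth_fun_at h p -> smooth_field_at Y p ->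
    cov p v (fun q => h q *: Y q) = fun_deriv h p v *: Y p + h p *: cov p v Y;
  cov_smooth : forall p X Y, smooth_field_at X p -> smooth_field_at Y p ->
    smooth_field_at (fun q => cov q (X q) Y) p
}.

Record riemannian_metric (R : realType) (n : nat) (M : manifold R n) :=
  RiemannianMetric {
  metric :> M -> 'rV[R]_n -> 'rV[R]_n -> R;
  metric_linear : forall p (c : R) u v w,
    metric p (c *: u + v) w = c * metric p u w + metric p v w;
  metricC : forall p u v, metric p u v = metric p v u;
  metric_gt0 : forall p v, v != 0 -> 0 < metric p v v;
  metric_smooth : forall p X Y, smooth_field_at X p -> smooth_field_at Y p ->
    smooth_fun_at (fun q => metric q (X q) (Y q)) p
}.

Section StatisticalManifolds.
Context {R : realType} {n : nat} {M : manifold R n}.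
Implicit Types (nabla lc : connection M) (g : riemannian_metric M).
Implicit Types (phi : M -> {linear 'rV[R]_n -> 'rV[R]_n}) (xi : M -> 'rV[R]_n).
Implicit Types (eta : M -> {scalar 'rV[R]_n}).

Definition torsion_free nabla : Prop :=
  forall p X Y, smooth_field_at X p -> smooth_field_at Y p ->
    nabla p (X p) Y - nabla p (Y p) X = lie_bracket X Y p.

Definition cov_metric nabla g (p : M) (v : 'rV[R]_n) (Y Z : M -> 'rV[R]_n) : R :=
  fun_deriv (fun q => g q (Y q) (Z q)) p v
  - g p (nabla p v Y) (Z p) - g p (Y p) (nabla p v Z).

Definition levi_civita g lc : Prop :=
  torsion_free lc /\
  forall p v Y Z, smooth_field_at Y p -> smooth_field_at Z p ->
    cov_metric lc g p v Y Z = 0.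

Definition statistical nabla g : Prop :=
  torsion_free nabla /\
  forall p X Y Z,
    smooth_field_at X p -> smooth_field_at Y p -> smooth_field_at Z p ->
    cov_metric nabla g p (X p) Y Z = cov_metric nabla g p (Y p) X Z.

Definition difference_tensor nabla lc (p : M) (v : 'rV[R]_n)
    (Y : M -> 'rV[R]_n) : 'rV[R]_n :=
  nabla p v Y - lc p v Y.

Record almost_contact_metric g phi xi eta : Prop := AlmostContactMetric {
  acm_odd : odd n;
  acm_phi_smooth : forall p X, smooth_field_at X p ->
    smooth_field_at (fun q => phi q (X q)) p;
  acm_xi_smooth : smooth_field xi;
  acm_eta_smooth : forall p X, smooth_field_at X p ->
    smooth_fun_at (fun q => eta q (X q)) p;
  acm_xi_unit : forall p, g p (xi p) (xi p) = 1;
  acm_phi_sqr : forall p v, phi p (phi p v) = - v + eta p v *: xi p;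
  acm_etaE : forall p v, g p v (xi p) = eta p v;
  acm_phi_metric : forall p u v,
    g p (phi p u) (phi p v) = g p u v - eta p u * eta p v
}.

Record sasakian_statistical nabla g phi xi eta lc : Prop :=
  SasakianStatistical {
  ss_statistical : statistical nabla g;
  ss_acm : almost_contact_metric g phi xi eta;
  ss_lc : levi_civita g lc;
  ss_lc_xi : forall p v, lc p v xi = phi p v;
  ss_lc_phi : forall p v Y, smooth_field_at Y p ->
    lc p v (fun q => phi q (Y q)) - phi p (lc p v Y)
    = g p (Y p) (xi p) *: v - g p (Y p) v *: xi p;
  ss_K_phi : forall p v Y, smooth_field_at Y p ->
    difference_tensor nabla lc p v (fun q => phi q (Y q))
    + phi p (difference_tensor nabla lc p v Y) = 0
}.

End StatisticalManifolds.

Section Submanifolds.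
Context {R : realType} {m n : nat} {M : manifold R m} {N : manifold R n}.
Implicit Types (nabla : connection N) (g : riemannian_metric N) (f : M -> N).
Implicit Types (phi : N -> {linear 'rV[R]_n -> 'rV[R]_n}) (xi : N -> 'rV[R]_n).
Implicit Types (V : M -> 'rV[R]_n) (D : M -> {vspace 'rV[R]_m}).

(* The ambient connection acting on vector fields along [f]: for
   V = \sum_k V^k d_k in the chart around [f p],
   nabla_v V = \sum_k (v(V^k) d_k + V^k nabla_{df v} d_k), and d_k at [f p] has
   components [delta_mx 0 k].  For the restriction V = W \o f of a vector field
   [W] of [N], this is nabla_{df v} W. *)
Definition cov_along nabla f (p : M) (v : 'rV[R]_m) V : 'rV[R]_n :=
  'd (local_field f V p) (chart_at p p) v
  + \sum_(k < n) V p 0 k *: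
      nabla (f p) (tangent_map f p v) (coord_field (f p) k).

(* The only [u] such that [w - df u] is normal to the submanifold. *)
Definition tangential_part g f (p : M) (w : 'rV[R]_n) : 'rV[R]_m :=
  xget 0 [set u | forall v,
    g (f p) (w - tangent_map f p u) (tangent_map f p v) = 0].

(* A_V v *)
Definition shape_operator nabla g f V (p : M) (v : 'rV[R]_m) : 'rV[R]_m :=
  - tangential_part g f p (cov_along nabla f p v V).

Definition orthogonal_distribution g f D : M -> set 'rV[R]_m :=
  fun p => [set v | forall u, u \in D p ->
    g (f p) (tangent_map f p u) (tangent_map f p v) = 0].

End Submanifolds.

Section Distributions.
Context {R : realType} {m : nat} {M : manifold R m}.

Definition smooth_distribution (D : M -> {vspace 'rV[R]_m}) : Prop :=
  exists r : nat, forall p, exists E : 'I_r -> M -> 'rV[R]_m,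
    (forall i, smooth_field_at (E i) p) /\
    \forall q \near p, basis_of (D q) [seq E i q | i <- enum 'I_r].

Definition section_of (D : M -> set 'rV[R]_m) (X : M -> 'rV[R]_m) : Prop :=
  smooth_field X /\ forall p, D p (X p).

(* Integrability in the sense of Warner, Foundations of Differentiable
   Manifolds and Lie Groups, Definition 1.56: closure under the Lie bracket. *)
Definition integrable_distribution (D : M -> set 'rV[R]_m) : Prop :=
  forall X Y, section_of D X -> section_of D Y ->
    forall p, D p (lie_bracket X Y p).

End Distributions.

Section ContactCR.
Context {R : realType} {m n : nat} {M : manifold R m} {N : manifold R n}.

(* TM is the direct sum of [D] and its orthogonal complement since the metric
   is positive definite. *)
Record contact_CR_submanifold (g : riemannian_metric N)
    (phi : N -> {linear 'rV[R]_n -> 'rV[R]_n}) (xi : N -> 'rV[R]_n)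
    (f : M -> N) (D : M -> {vspace 'rV[R]_m}) : Prop := ContactCRSubmanifold {
  ccr_submanifold : submanifold f;
  ccr_smooth : smooth_distribution D;
  ccr_xi : forall p, exists2 u, u \in D p & tangent_map f p u = xi (f p);
  ccr_invariant : forall p u, u \in D p ->
    exists2 w, w \in D p & phi (f p) (tangent_map f p u) = tangent_map f p w;
  ccr_anti_invariant : forall p u, orthogonal_distribution g f D p u ->
    forall w, g (f p) (phi (f p) (tangent_map f p u)) (tangent_map f p w) = 0
}.

End ContactCR.

(* Main.v *)
Require Import Defs.
From HB Require Import structures.
From mathcomp Require Import all_boot all_order all_algebra.
From mathcomp Require Import all_classical all_reals all_analysis.
Import Order.TTheory GRing.Theory Num.Theory.
Import numFieldNormedType.Exports.
Set Implicit Arguments.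
Unset Strict Implicit.
Unset Printing Implicit Defensive.
Local Open Scope classical_set_scope.
Local Open Scope ring_scope.

(** Write $nabla^*$ for the dual connection, $hat nabla$ for the Levi-Civita
    connection, and $P$ for the tangential projection. Since
    $nabla^* = 2 hat nabla - nabla$, the Sasakian identities for $hat nabla$ and
    the anti-commutation of $K = nabla - hat nabla$ with $phi$ give, for a field
    $V$ along the immersion $f$ and a tangent vector $v$,
      $nabla_v (phi V)
         = phi (nabla^*_v V) + g(V, xi) df v - g(V, df v) xi$
    ([cov_along_phi]). Put $V = df Y$ and $v = X$ with $X, Y$ sections of
    $D^perp$, and subtract the same formula with $X$ and $Y$ exchanged. The
    multiples of $df X$ and $df Y$ vanish because $D^perp$ is orthogonal to
    $xi in D$, those of $xi$ cancel by the symmetry of $g$, and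
    $nabla^*$ is torsion free, so that
      $A_{phi Y} X - A_{phi X} Y = - P (phi (df [X, Y]))$
    ([shape_operator_phi]). The right-hand side of the condition in the theorem
    is zero for sections of $D^perp$, so the condition says that
    $phi (df [X, Y])$ is normal to $M$.

    If $[X, Y]$ lies in $D^perp$, this is the anti-invariance of $D^perp$.
    Conversely, let $phi (df [X, Y])$ be normal and $u in D$. As $phi (df u)$ is
    tangent,
      $0 = g(phi (df [X, Y]), phi (df u))
         = g(df [X, Y], df u) - eta(df [X, Y]) eta(df u)$,
    and $eta(df [X, Y]) = 0$: differentiating $g(df Y, xi) = 0$ along $X$ gives
    $g(hat nabla_X (df Y), xi) = - g(df Y, phi (df X)) = 0$, again by
    anti-invariance ([lie_bracket_xi], [phi_bracket_normal]).

    Everything takes place along $f$ and in charts, and the analytic content is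
    concentrated in three facts. Torsion freeness passes to fields along $f$,
    [cov_along_lie_bracket]; in coordinates this is the symmetry of the
    Christoffel symbols together with the equality of mixed partial derivatives
    of $f$ ([derive_commute], [tangent_lie_bracket]). A tensor field of the
    ambient manifold obeys a Leibniz rule on fields along $f$
    ([is_diff_tensor_along]); it is used for $phi$ and for $g(., xi)$. Finally a
    connection is determined by its values on coordinate fields ([cov_coord]),
    which rests on the locality of connections ([near_eq_cov]). *)

(** * Rules of differentiation *)

Section Differentials.
Context {R : realType}.
Implicit Types (V W : normedModType R).

(** A differential depends only on the germ of the map; chart expressions of
    maps agree only near a point, so every chain rule below ends with this. *)
Lemma near_eq_is_diff V W (f g df : V -> W) x :
  (\near x, f x = g x) -> is_diff x f df -> is_diff x g df.
Proof.
move=> fg [dfx <-].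
have gE : g \o shift x = cst (g x) + 'd f x +o_ 0 id.
  apply/eqaddoP => e e0.
  have /eqaddoP/(_ e e0) fd := diff_locally dfx.
  have fg0 : \forall h \near (0 : V), f (h + x) = g (h + x).
    by move/nbhs0P : fg; apply: filterS => h; rewrite addrC.
  apply: filterS2 fd fg0 => h + fgh.
  by rewrite !fctE /= fgh (nbhs_singleton fg).
have dgE := diff_unique (diff_continuous dfx) gE.
apply: DiffDef => //; apply/diff_locallyP; rewrite dgE; split=> //.
exact: diff_continuous.
Qed.

(** Product rule for the bilinear continuous map $(r, w) |-> r w$. *)
Lemma is_diff_scale V W (a da : V -> R) (b db : V -> W) x :
  is_diff x a da -> is_diff x b db ->
  is_diff x (fun y => a y *: b y) (fun v => a x *: db v + da v *: b x).
Proof.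
move=> ax bx.
have sbil : bilinear_for (GRing.Scale.Law.clone _ _ *:%R _)
    (GRing.Scale.Law.clone _ _ *:%R _) (@GRing.scale R W).
  split=> [w|r] c u v /=; first by rewrite scalerDl scalerA.
  by rewrite scalerDr !scalerA mulrC.
pose sM := bilinear_isBilinear.Build R R W W _ _ (@GRing.scale R W) sbil.
pose s : {bilinear R -> W -> W} := HB.pack (@GRing.scale R W) sM.
have sc : continuous (fun p : R * W => s p.1 p.2) by exact: scale_continuous.
have sd (p : R * W) : is_diff p (fun q => q.1 *: q.2)
    (fun q => p.1 *: q.2 + q.1 *: p.2).
  apply: DiffDef; first exact: (differentiable_bilin _ sc).
  exact: (diff_bilin p sc).
rewrite (_ : (fun y => _) = (fun q => q.1 *: q.2) \o (fun y => (a y, b y)))//.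
have := is_diff_comp (is_diff_pair ax bx) (sd (a x, b x)).
by apply.
Qed.

Lemma is_diff_sum V W n (f df : 'I_n -> V -> W) x :
  (forall i, is_diff x (f i) (df i)) ->
  is_diff x (fun y => \sum_i f i y) (fun v => \sum_i df i v).
Proof.
move=> fdf.
have sumE (g : 'I_n -> V -> W) : (fun y => \sum_i g i y) = \sum_i g i.
  by apply/funext => y; rewrite fct_sumE.
rewrite !sumE.
by elim/big_ind2 : _ => *; [exact: is_diff_cst|exact: is_diffD|exact: fdf].
Qed.

End Differentials.

(** * Equality of mixed partial derivatives *)

Section SecondDerivatives.
Context {R : realType} {V : normedModType R}.

Lemma is_derive_line (F : V -> R) (u w : V) (s : R) :
  differentiable F (s *: u + w) ->
  is_derive s 1 (fun t => F (t *: u + w)) ('D_u F (s *: u + w)).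
Proof.
move=> dF; have line : is_diff s (fun t : R => t *: u + w) (fun t => t *: u).
  rewrite (_ : (fun t => _) = ( *:%R ^~ u : R -> V) + cst w)//.
  by apply: is_diff_eq; rewrite addr0.
have := is_diff_comp line (differentiableP dF) => -[dFl dFlE].
apply: DeriveDef; first exact: diff_derivable.
by rewrite !deriveE// dFlE /= scale1r.
Qed.

Lemma MVT_from0 (a da : R -> R) (h : R) : 0 < h ->
  (forall s, 0 <= s <= h -> is_derive s 1 a (da s)) ->
  exists2 c, 0 <= c <= h & a h - a 0 = da c * h.
Proof.
move=> h0 aD; have [|c|c] := @MVT_segment R a da 0 h (ltW h0).
- by move=> s; rewrite in_itv /= => /andP[s0 sh]; apply: aD; rewrite !ltW.
- apply: derivable_within_continuous => s; rewrite in_itv /= => sh.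
  by have [] := aD s sh.
by rewrite in_itv /= subr0 => ch E; exists c.
Qed.

(** Apply the mean value theorem to $s |-> F(x + s u + h v) - F(x + s u)$,
    and then to the directional derivative of $F$ along $u$ in the direction
    $v$. *)
Lemma second_difference (F : V -> R) (u v x : V) (r h : R) : 0 < h ->
  h * (`|u| + `|v|) < r ->
  (forall y, ball x r y -> differentiable F y) ->
  (forall y, ball x r y -> differentiable ('D_u F) y) ->
  exists2 z, ball x r z &
    F (h *: u + (h *: v + x)) - F (h *: u + x) - (F (h *: v + x) - F x)
    = h * h * 'D_v ('D_u F) z.
Proof.
move=> h0 hr dF ddF.
have inb (s t : R) : 0 <= s <= h -> 0 <= t <= h ->
    ball x r (s *: u + (t *: v + x)).
  move=> /andP[s0 sh] /andP[t0 th]; rewrite -ball_normE /= distrC addrA addrK.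
  apply: le_lt_trans hr; rewrite (le_trans (ler_normD _ _))// mulrDr !normrZ.
  by rewrite !ger0_norm// lerD// ler_wpM2r.
have h00 : 0 <= h <= h by rewrite lexx ltW.
have z00 : 0 <= (0 : R) <= h by rewrite lexx ltW.
have line0 (s : R) : s *: u + x = s *: u + ((0 : R) *: v + x).
  by rewrite scale0r add0r.
pose a (s : R) := F (s *: u + (h *: v + x)) - F (s *: u + x).
pose da (s : R) := 'D_u F (s *: u + (h *: v + x)) - 'D_u F (s *: u + x).
have aD s : 0 <= s <= h -> is_derive s 1 a (da s).
  move=> sh; apply: is_deriveB; apply: is_derive_line; apply: dF.
    exact: inb.
  by rewrite line0; exact: inb.
have [c ch aE] := MVT_from0 h0 aD.
pose b (t : R) := 'D_u F (t *: v + (c *: u + x)).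
have lineb (t : R) : t *: v + (c *: u + x) = c *: u + (t *: v + x).
  exact: addrCA.
pose db (t : R) := 'D_v ('D_u F) (t *: v + (c *: u + x)).
have bD t : 0 <= t <= h -> is_derive t 1 b (db t).
  move=> th; apply: is_derive_line; apply: ddF; rewrite lineb.
  exact: inb.
have [d dh bE] := MVT_from0 h0 bD.
exists (c *: u + (d *: v + x)); first exact: inb.
move: aE bE; rewrite /a /b /da /db !lineb !scale0r !add0r => aE bE.
by rewrite aE bE -mulrA mulrC.
Qed.

(** Schwarz: the second difference is symmetric in $u$ and $v$, so by
    [second_difference] each mixed derivative, at some point close to $x$,
    equals the same quotient by $h^2$; continuity at $x$ concludes. *)
Lemma derive_commute (F : V -> R) (u v x : V) :
  (\near x, differentiable F x) ->
  (\near x, differentiable ('D_u F) x) ->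
  (\near x, differentiable ('D_v F) x) ->
  {for x, continuous ('D_v ('D_u F))} ->
  {for x, continuous ('D_u ('D_v F))} ->
  'D_v ('D_u F) x = 'D_u ('D_v F) x.
Proof.
move=> dF duF dvF cvu cuv; apply/eqP; rewrite -subr_eq0 -normr_le0.
apply/ler_addgt0Pl => e e0; rewrite addr0.
have e20 : 0 < e / 2 by rewrite divr_gt0.
move/cvgrPdist_le : cvu => /(_ _ e20) cvu.
move/cvgrPdist_le : cuv => /(_ _ e20) cuv.
have [r /= r0 xr] : exists2 r : R, 0 < r & forall y, ball x r y ->
    [/\ differentiable F y, differentiable ('D_u F) y,
        differentiable ('D_v F) y,
        `|'D_v ('D_u F) x - 'D_v ('D_u F) y| <= e / 2 &
        `|'D_u ('D_v F) x - 'D_u ('D_v F) y| <= e / 2].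
  have [/= r r0 xr] := (nbhs_ballP _ _).1
    (filterI (filterI dF duF) (filterI dvF (filterI cvu cuv))).
  exists r; first exact: r0.
  move=> y xy; have [[Fy uFy] [vFy [vuy uvy]]] := xr y xy.
  split; [exact: Fy|exact: uFy|exact: vFy|exact: vuy|exact: uvy].
(* With this [h] all the points of both second differences lie in the ball. *)
pose h := r / (`|u| + `|v| + 1).
have uv1 : 0 < `|u| + `|v| + 1 by rewrite ltr_wpDl// addr_ge0.
have h0 : 0 < h by rewrite divr_gt0.
have huv : h * (`|u| + `|v|) < r.
  by rewrite /h mulrAC ltr_pdivrMr// ltr_pM2l// ltrDl.
have hvu : h * (`|v| + `|u|) < r by rewrite [_ + `|u|]addrC.
have dFr y : ball x r y -> differentiable F y by case/xr.
have duFr y : ball x r y -> differentiable ('D_u F) y by case/xr.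
have dvFr y : ball x r y -> differentiable ('D_v F) y by case/xr.
have [z xz zE] := second_difference h0 huv dFr duFr.
have [z' xz' z'E] := second_difference h0 hvu dFr dvFr.
have swap (a b c d : R) : a - b - (c - d) = a - c - (b - d).
  by rewrite !opprD addrACA.
have zz' : 'D_v ('D_u F) z = 'D_u ('D_v F) z'.
  apply: (mulfI (x := h * h)); first by rewrite mulf_neq0// gt_eqF.
  apply: etrans (esym zE) (etrans _ z'E).
  have -> : h *: u + (h *: v + x) = h *: v + (h *: u + x) by exact: addrCA.
  exact: swap.
have [_ _ _ + _] := xr z xz; have [_ _ _ _ +] := xr z' xz'; rewrite zz'.
clear -e e0.
move: ('D_v ('D_u F) x) ('D_u ('D_v F) x) ('D_u ('D_v F) z') => A B C BC AC.
by rewrite (splitr e) (le_trans (ler_distD C _ _))// lerD// distrC.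
Qed.

End SecondDerivatives.

(** * Smooth maps *)

Section CoordLin.
Context {R : realType} {n : nat} (k : 'I_n).
Definition coord_lin (u : 'rV[R]_n) : R := u 0 k.
Fact coord_lin_is_linear : scalar coord_lin.
Proof. by move=> a u v; rewrite /coord_lin !mxE. Qed.
HB.instance Definition _ :=
  GRing.isLinear.Build R 'rV[R]_n R *%R coord_lin coord_lin_is_linear.

Lemma is_diff_coord (u : 'rV[R]_n) :
  is_diff u (fun v : 'rV[R]_n => v 0 k) (fun v => v 0 k).
Proof.
have cL : continuous coord_lin by exact: coord_continuous.
by apply: DiffDef; [exact: differentiable_coord|exact: (diff_lin u cL)].
Qed.
End CoordLin.

Section SmoothMapsTheory.
Context {R : realType} {n : nat}.
Implicit Types (W : normedModType R) (x : 'rV[R]_n).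

(** [smooth_at] asks all the iterated derivatives to be differentiable on
    one common neighbourhood, so the equality of germs is carried through all of
    them on the same neighbourhood. *)
Lemma near_eq_smooth_at W (f g : 'rV[R]_n -> W) x :
  (\near x, f x = g x) -> smooth_at x f -> smooth_at x g.
Proof.
move=> /near_join fg /near_join sf; rewrite /smooth_at.
near=> y.
have fgy : \near y, f y = g y by near: y.
have sfy : \near y, forall s, differentiable (iter_partial f s) y by near: y.
have E s : forall z, (\near z, f z = g z) -> 
    iter_partial f s z = iter_partial g s z.
  elim: s => [z /nbhs_singleton //|i s IH z fgz /=].
  apply: near_eq_derive; move/near_join : fgz; apply: filterS => t; exact: IH.
move=> s.
have := differentiableP (nbhs_singleton sfy s).
move=> /near_eq_is_diff -/(_ (iter_partial g s))[]//.
by move/near_join : fgy; apply: filterS; exact: E.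
Unshelve. all: by end_near. Qed.

Lemma smooth_at_differentiable W (f : 'rV[R]_n -> W) x :
  smooth_at x f -> differentiable f x.
Proof. by move=> /nbhs_singleton/(_ [::]). Qed.

Lemma smooth_at_cst W (c : W) x : smooth_at x (fun=> c).
Proof.
rewrite /smooth_at; near=> y => s.
suff [d ->] : exists d, iter_partial (fun=> c) s = cst d by [].
elim: s => [|i s [d /= ->]]; first by exists c.
by exists 0; apply/funext => z; rewrite derive_cst.
Unshelve. all: by end_near. Qed.

Lemma iter_partial_linear W W' (L : {linear W -> W'}) (f : 'rV[R]_n -> W) x :
  continuous L -> smooth_at x f ->
  \near x, forall s, iter_partial (L \o f) s x = L (iter_partial f s x).
Proof.
move=> cL /near_join; apply: filterS => y sf s; elim: s y sf => //= i s IH y sf.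
have fs := nbhs_singleton sf s.
rewrite (near_eq_derive (g := L \o iter_partial f s)); last first.
  by move/near_join : sf; apply: filterS; exact: IH.
rewrite !deriveE//; last exact/differentiable_comp/linear_differentiable.
by rewrite diff_comp//= ?diff_lin//; exact: linear_differentiable.
Qed.

Lemma smooth_at_linear W W' (L : {linear W -> W'}) (f : 'rV[R]_n -> W) x :
  continuous L -> smooth_at x f -> smooth_at x (L \o f).
Proof.
move=> cL sf; have := near_join (iter_partial_linear cL sf); rewrite /smooth_at.
apply: filterS2 sf => y sf Lf s.
have Ls : differentiable (L \o iter_partial f s) y.
  exact/differentiable_comp/linear_differentiable.
have Lfs : \near y, (L \o iter_partial f s) y = iter_partial (L \o f) s y.
  by apply: filterS Lf => z /(_ s).
by have [] := near_eq_is_diff Lfs (differentiableP Ls).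
Qed.

(** [derive_commute] needs real values; a vector-valued map is reduced to
    its coordinates, which commute with iterated derivatives by
    [iter_partial_linear]. *)
Lemma iter_partialC p (f : 'rV[R]_n -> 'rV[R]_p) x i j : smooth_at x f ->
  iter_partial f [:: i; j] x = iter_partial f [:: j; i] x.
Proof.
move=> sf; apply/rowP => k.
have cL : continuous (@coord_lin R p k).
  exact: coord_continuous.
have E s : iter_partial (@coord_lin R p k \o f) s x = iter_partial f s x 0 k.
  by have /nbhs_singleton/(_ s) := iter_partial_linear cL sf.
apply: etrans (esym (E [:: i; j])) (etrans _ (E [:: j; i])).
have := smooth_at_linear cL sf; clear E sf.
move: (@coord_lin R p k \o f) => F sF.
apply: derive_commute.
- by apply: filterS sF => y /(_ [::]).
- by apply: filterS sF => y /(_ [:: j]).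
- by apply: filterS sF => y /(_ [:: i]).
- apply: differentiable_continuous; exact: (nbhs_singleton sF [:: i; j]).
- apply: differentiable_continuous; exact: (nbhs_singleton sF [:: j; i]).
Qed.

End SmoothMapsTheory.

(** * Linear maps on row vectors and second differentials *)

Section LinearMaps.
Context {R : realType} {n : nat}.

Lemma linear_combination (V W : lmodType R) (T : V -> W) I (r : seq I)
    (a : I -> R) (v : I -> V) : linear T ->
  T (\sum_(i <- r) a i *: v i) = \sum_(i <- r) a i *: T (v i).
Proof.
move=> lT; pose lM := GRing.isLinear.Build _ _ _ _ T lT.
pose L : {linear V -> W} := HB.pack T lM.
rewrite -[T]/(L : V -> W) linear_sum; apply: eq_bigr => i _.
by rewrite linearZ.
Qed.

Lemma linear_row_sum (W : lmodType R) (T : 'rV[R]_n -> W) u : linear T ->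
  T u = \sum_k u 0 k *: T (delta_mx 0 k).
Proof. by move=> lT; rewrite -linear_combination// -row_sum_delta. Qed.

Lemma linear_rV_continuous (W : normedModType R) (L : {linear 'rV[R]_n -> W}) :
  continuous L.
Proof.
have -> : (L : _ -> _) = fun u => \sum_k u 0 k *: L (delta_mx 0 k).
  by apply/funext => u; apply: linear_row_sum => a x y; rewrite linearP.
move=> u; apply: differentiable_continuous.
have [//] := is_diff_sum (fun k =>
  is_diff_scale (is_diff_coord k u) (is_diff_cst (L (delta_mx 0 k)) u)).
Qed.

End LinearMaps.

Section SecondDifferential.
Context {R : realType} {m n : nat}.
Implicit Types (F : 'rV[R]_m -> 'rV[R]_n).

(** The Hessian of $F$ at $x$, as a vector-valued bilinear form. *)
Definition diff2 F x (u v : 'rV[R]_m) : 'rV[R]_n :=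
  \sum_i u 0 i *: 'd (iter_partial F [:: i]) x v.

Lemma diff2C F x u v : smooth_at x F -> diff2 F x u v = diff2 F x v u.
Proof.
move=> sF; have dF i := nbhs_singleton sF [:: i].
have E i w : 'd (iter_partial F [:: i]) x w
    = \sum_j w 0 j *: iter_partial F [:: j; i] x.
  rewrite (linear_row_sum w (T := 'd (iter_partial F [:: i]) x)); last first.
    by move=> a y z; rewrite linearP.
  by apply: eq_bigr => j _; rewrite /= deriveE//; exact: dF.
rewrite /diff2.
transitivity (\sum_i \sum_j (u 0 i * v 0 j) *: iter_partial F [:: j; i] x).
  apply: eq_bigr => i _; rewrite E scaler_sumr.
  by apply: eq_bigr => j _; rewrite scalerA.
rewrite exchange_big; apply: eq_bigr => j _.
rewrite E scaler_sumr; apply: eq_bigr => i _.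
by rewrite scalerA mulrC iter_partialC.
Qed.

(** Derivative of the pushforward $y |-> dF_y (Y y)$ of a variable vector:
    the source of the Hessian term when $df Y$ is differentiated along $f$. *)
Lemma is_diff_diff F x (Y dY : 'rV[R]_m -> 'rV[R]_m) : smooth_at x F ->
  is_diff x Y dY ->
  is_diff x (fun y => 'd F y (Y y))
    (fun v => 'd F x (dY v) + diff2 F x (Y x) v).
Proof.
move=> sF Yx.
have E y w : differentiable F y ->
    'd F y w = \sum_i w 0 i *: iter_partial F [:: i] y.
  move=> dF; rewrite (linear_row_sum w (T := 'd F y)); last first.
    by move=> a z t; rewrite linearP.
  by apply: eq_bigr => i _ /=; rewrite deriveE.
apply: (@near_eq_is_diff _ _ _
  (fun y => \sum_i (Y y) 0 i *: iter_partial F [:: i] y)).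
  by apply: filterS sF => y /(_ [::]) dF; rewrite E.
have dYi i : is_diff x (fun y => (Y y) 0 i) (fun v => (dY v) 0 i).
  by have := is_diff_comp Yx (is_diff_coord i (Y x)).
apply: is_diff_eq (is_diff_sum (fun i =>
  is_diff_scale (dYi i) (differentiableP (nbhs_singleton sF [:: i])))) _.
apply/funext => v; have dFE := E _ (dY v) (smooth_at_differentiable sF).
rewrite big_split /= addrC.
exact: (esym (congr1 (fun w => w + diff2 F x (Y x) v) dFE)).
Qed.

End SecondDifferential.

(** * Changes of charts *)

Section Charts.
Context {R : realType} {n : nat} {M : manifold R n}.
Implicit Types (W : normedModType R) (a b c p q : M).

HB.instance Definition _ a b q := GRing.Linear.copy (@chart_change R n M a b q)
  ('d (chart_at b \o chart_inv (chart_at a)) (chart_at a q)).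

Lemma near_chart_dom a q : chart_dom (chart_at a) q ->
  \near q, chart_dom (chart_at a) q.
Proof.
by move=> aq; apply: open_nbhs_nbhs; split=> //; exact: chart_dom_open.
Qed.

Lemma near_chart_inv a q (P : set M) : chart_dom (chart_at a) q ->
  (\near q, P q) -> \forall x \near chart_at a q, P (chart_inv (chart_at a) x).
Proof.
move=> aq qP; apply: (chart_inv_cont aq).
by rewrite chart_funK.
Qed.

Lemma near_chart_invK a q : chart_dom (chart_at a) q ->
  \forall x \near chart_at a q, chart_at a (chart_inv (chart_at a) x) = x.
Proof.
move=> aq; suff : nbhs (chart_at a q) (chart_at a @` chart_dom (chart_at a)).
  by apply: filterS => _ [p ap <-]; rewrite chart_funK.
apply: open_nbhs_nbhs; split; first exact: chart_codom_open.
by exists q.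
Qed.

(** Transfers properties of points of the manifold near $q$ to coordinate
    vectors near the image of $q$: the range of a chart is open. *)
Lemma near_chart_at a q (P : 'rV[R]_n -> Prop) : chart_dom (chart_at a) q ->
  (\forall p \near q, chart_dom (chart_at a) p -> P (chart_at a p)) ->
  \forall x \near chart_at a q, P x.
Proof.
move=> aq qP; apply: filterS3 (near_chart_invK aq) (near_chart_inv aq qP)
  (near_chart_inv aq (near_chart_dom aq)) => x xE + ax.
by rewrite xE; apply.
Qed.

Lemma is_diff_chart_change a b q :
  chart_dom (chart_at a) q -> chart_dom (chart_at b) q ->
  is_diff (chart_at a q) (chart_at b \o chart_inv (chart_at a))
    (chart_change a b q).
Proof.
move=> aq bq; apply: differentiableP.
exact/smooth_at_differentiable/transition_smooth.
Qed.

(** Taking for $h$ a chart gives the cocycle rule for [chart_change], and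
    for $h$ a map read in a target chart gives its differential in any source
    chart. *)
Lemma is_diff_chart_source W (h : M -> W) a b q (dh : 'rV[R]_n -> W) :
  chart_dom (chart_at a) q -> chart_dom (chart_at b) q ->
  is_diff (chart_at a q) (h \o chart_inv (chart_at a)) dh ->
  is_diff (chart_at b q) (h \o chart_inv (chart_at b))
    (dh \o chart_change b a q).
Proof.
move=> aq bq hq.
have E : (chart_at a \o chart_inv (chart_at b)) (chart_at b q) = chart_at a q.
  by rewrite /= chart_funK.
have := is_diff_comp (is_diff_chart_change bq aq).
rewrite E => /(_ _ _ _ hq); apply: near_eq_is_diff.
apply: near_chart_at => //; apply: filterS (near_chart_dom aq) => p ap bp /=.
by rewrite chart_funK // chart_funK.
Qed.

Lemma chart_change_comp a b c q v : chart_dom (chart_at a) q ->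
  chart_dom (chart_at b) q -> chart_dom (chart_at c) q ->
  chart_change b c q (chart_change a b q v) = chart_change a c q v.
Proof.
move=> aq bq cq.
have [_] := is_diff_chart_source bq aq (is_diff_chart_change bq cq).
by move=> /(congr1 (fun F => F v)).
Qed.

Lemma chart_change_id a q v : chart_dom (chart_at a) q ->
  chart_change a a q v = v.
Proof.
move=> aq; have [_ E] : is_diff (chart_at a q)
    (chart_at a \o chart_inv (chart_at a)) id.
  apply: near_eq_is_diff (is_diff_id _).
  by apply: near_chart_at => //; near=> p => ap /=; rewrite chart_funK.
by rewrite /chart_change E.
Unshelve. all: by end_near. Qed.

Lemma chart_changeK a b q : chart_dom (chart_at a) q ->
  chart_dom (chart_at b) q -> cancel (chart_change a b q) (chart_change b a q).
Proof. by move=> aq bq v; rewrite chart_change_comp// chart_change_id. Qed.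

End Charts.

(** * Vector fields along a map *)

Section MapsInCharts.
Context {R : realType} {m n : nat} {M : manifold R m} {N : manifold R n}.
Variable f : M -> N.
Hypothesis sf : smooth_map f.
Implicit Types (p q : M).

HB.instance Definition _ p := GRing.Linear.copy (tangent_map f p)
  ('d (local_map f p) (chart_at p p)).

Lemma is_diff_local_map p :
  is_diff (chart_at p p) (local_map f p) (tangent_map f p).
Proof. exact/differentiableP/smooth_at_differentiable/(sf p).2. Qed.

Lemma near_map_chart_dom b q : chart_dom (chart_at b) (f q) ->
  \forall r \near q, chart_dom (chart_at b) (f r).
Proof. by move=> bfq; exact: (sf q).1 _ (near_chart_dom bfq). Qed.

Lemma is_diff_map_charts a b q : chart_dom (chart_at a) q ->
  chart_dom (chart_at b) (f q) ->
  is_diff (chart_at a q) (chart_at b \o f \o chart_inv (chart_at a))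
    (chart_change (f q) b (f q) \o tangent_map f q \o chart_change a q q).
Proof.
move=> aq bfq; apply: is_diff_chart_source (mem_chart_at q) aq _.
have fqq := mem_chart_at (f q).
have E : local_map f q (chart_at q q) = chart_at (f q) (f q).
  by rewrite /local_map /= chart_funK//; exact: mem_chart_at.
have := is_diff_comp (is_diff_local_map q); rewrite E.
move=> /(_ _ _ _ (is_diff_chart_change fqq bfq)).
apply: near_eq_is_diff; apply: near_chart_at; first exact: mem_chart_at.
apply: filterS (near_map_chart_dom fqq) => p fp qp.
by rewrite /local_map /= chart_funK// chart_funK.
Qed.

(** In coordinates fixed around $p$ and $f p$, the field $df Y$ is the
    coordinate differential of $f$ applied to the coordinates of $Y$: the
    definition uses charts that vary with the point, and the changes of charts
    cancel. *)
Lemma local_field_tangent p (Y : M -> 'rV[R]_m) :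
  \forall x \near chart_at p p,
    local_field f (fun q => tangent_map f q (Y q)) p x
    = 'd (local_map f p) x (local_field (@id M) Y p x).
Proof.
have pp := mem_chart_at p; have fpp := mem_chart_at (f p).
apply: near_chart_at => //.
apply: filterS2 (near_chart_dom pp) (near_map_chart_dom fpp) => q pq fq _.
have [_ E] := is_diff_map_charts pq fq.
rewrite /local_field /= chart_funK//.
set u := chart_change q p q (Y q).
apply: etrans (esym (congr1 (fun L => L u) E)).
by rewrite /u /= chart_changeK//; exact: mem_chart_at.
Qed.

Lemma local_field_id_self p (Y : M -> 'rV[R]_m) :
  local_field (@id M) Y p (chart_at p p) = Y p.
Proof.
have pp := mem_chart_at p.
by rewrite /local_field /= chart_funK// chart_change_id.
Qed.

Lemma is_diff_local_field_tangent p (Y : M -> 'rV[R]_m) : smooth_field_at Y p ->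
  is_diff (chart_at p p) (local_field f (fun q => tangent_map f q (Y q)) p)
    (fun v => tangent_map f p ('d (local_field (@id M) Y p) (chart_at p p) v)
      + diff2 (local_map f p) (chart_at p p) (Y p) v).
Proof.
move=> sY.
have := is_diff_diff (sf p).2 (differentiableP (smooth_at_differentiable sY)).
rewrite local_field_id_self; apply: near_eq_is_diff.
by apply: filterS (local_field_tangent p Y).
Qed.

(** The Hessian terms of [is_diff_local_field_tangent] cancel by symmetry,
    and the first-order terms are the coordinate expression of the bracket. *)
Lemma tangent_lie_bracket p (X Y : M -> 'rV[R]_m) :
  smooth_field_at X p -> smooth_field_at Y p ->
  'd (local_field f (fun q => tangent_map f q (Y q)) p) (chart_at p p) (X p)
  - 'd (local_field f (fun q => tangent_map f q (X q)) p) (chart_at p p) (Y p)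
  = tangent_map f p (lie_bracket X Y p).
Proof.
move=> sX sY.
have [_ /(congr1 (fun L => L (Y p))) dX] := is_diff_local_field_tangent sX.
have [_ /(congr1 (fun L => L (X p))) dY] := is_diff_local_field_tangent sY.
apply: etrans (congr2 (fun u v => u - v) dY dX) _.
rewrite (diff2C _ _ (sf p).2) opprD addrACA subrr addr0.
by rewrite /lie_bracket linearB.
Qed.

(** Near $p$, $V$ is the combination of the coordinate fields of the chart
    at $f p$ with its components as coefficients, and $T$ is linear: the product
    and chain rules apply to each summand. *)
Lemma is_diff_tensor_along (W : normedModType R) (T : N -> 'rV[R]_n -> W)
    (dT : 'I_n -> 'rV[R]_n -> W) (V : M -> 'rV[R]_n) p
    (dV : 'rV[R]_m -> 'rV[R]_n) :
  (forall P, linear (T P)) ->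
  is_diff (chart_at p p) (local_field f V p) dV ->
  (forall k, is_diff (chart_at (f p) (f p))
    (fun y => T (chart_inv (chart_at (f p)) y)
      (coord_field (f p) k (chart_inv (chart_at (f p)) y))) (dT k)) ->
  is_diff (chart_at p p)
    (fun x => T (f (chart_inv (chart_at p) x)) (V (chart_inv (chart_at p) x)))
    (fun v => T (f p) (dV v) + \sum_k V p 0 k *: dT k (tangent_map f p v)).
Proof.
move=> lT dVp dTp.
have pp := mem_chart_at p; have fpp := mem_chart_at (f p).
pose Phi k y := T (chart_inv (chart_at (f p)) y)
  (coord_field (f p) k (chart_inv (chart_at (f p)) y)).
have FpE : local_map f p (chart_at p p) = chart_at (f p) (f p).
  by rewrite /local_map /= chart_funK.
have VpE : local_field f V p (chart_at p p) = V p.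
  by rewrite /local_field /= chart_funK// chart_change_id.
apply: (@near_eq_is_diff _ _ _ (fun x =>
    \sum_k local_field f V p x 0 k *: Phi k (local_map f p x))).
  apply: near_chart_at => //.
  apply: filterS2 (near_chart_dom pp) (near_map_chart_dom fpp) => q pq fq _.
  rewrite /local_field /local_map /Phi /= !chart_funK// -linear_combination//.
  rewrite /coord_field; congr (T _ _).
  transitivity (chart_change (f p) (f q) (f q)
    (chart_change (f q) (f p) (f q) (V q))); last first.
    by rewrite chart_changeK//; exact: mem_chart_at.
  rewrite [in RHS](row_sum_delta (chart_change (f q) (f p) (f q) (V q))).
  by rewrite linear_sum; apply: eq_bigr => k _; rewrite linearZ.
have dVk k : is_diff (chart_at p p) (fun x => local_field f V p x 0 k)
    (fun v => dV v 0 k).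
  exact: is_diff_comp dVp (is_diff_coord k _).
have dPhi k : is_diff (chart_at p p) (Phi k \o local_map f p)
    (dT k \o tangent_map f p).
  by apply: (is_diff_comp (is_diff_local_map p)); rewrite FpE; exact: dTp.
apply: is_diff_eq (is_diff_sum (fun k => is_diff_scale (dVk k) (dPhi k))) _.
apply/funext => v; rewrite big_split /= VpE addrC; congr (_ + _).
rewrite (linear_row_sum (dV v) (lT (f p))); apply: eq_bigr => k _.
by rewrite FpE /Phi chart_funK// /coord_field chart_change_id.
Qed.

End MapsInCharts.

(** * Connections in coordinates *)

Section Connections.
Context {R : realType} {n : nat} {N : manifold R n}.
Variable nabla : connection N.
Implicit Types (P Q : N) (Y Z : N -> 'rV[R]_n) (v w : 'rV[R]_n).

Lemma near_eq_smooth_field_at Y Z P : (\near P, Y P = Z P) ->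
  smooth_field_at Y P -> smooth_field_at Z P.
Proof.
move=> YZ; apply: near_eq_smooth_at.
apply: filterS (near_chart_inv (mem_chart_at P) YZ) => x.
by rewrite /local_field /= => ->.
Qed.

Lemma smooth_field_at0 P : smooth_field_at (fun=> 0 : 'rV[R]_n) P.
Proof.
apply: near_eq_smooth_at (smooth_at_cst 0 _); near=> x.
by rewrite /local_field /= linear0.
Unshelve. all: by end_near. Qed.

(** The field equals $h Y$ for the function $h$ that vanishes exactly at the
    zeros of $Y$ and is 1 elsewhere; $h$ is smooth at $P$, being zero near $P$.
    *)
Lemma near0_cov P v Y : (\near P, Y P = 0) -> nabla P v Y = 0.
Proof.
move=> Y0.
have sY : smooth_field_at Y P.
  apply: near_eq_smooth_field_at (smooth_field_at0 P).
  by apply: filterS Y0.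
pose h Q : R := if Y Q == 0 then 0 else 1.
have sh : smooth_fun_at h P.
  apply: near_eq_smooth_at (smooth_at_cst 0 _).
  apply: filterS (near_chart_inv (mem_chart_at P) Y0) => x /= Yx.
  by rewrite /h Yx eqxx.
have -> : Y = fun Q => h Q *: Y Q.
  apply/funext => Q; rewrite /h.
  by case: eqP => [->|_]; rewrite ?scaler0 ?scale1r.
rewrite covZ// /h (nbhs_singleton Y0) eqxx.
by rewrite scaler0 scale0r addr0.
Qed.

Lemma near_eq_cov P v Y Z : (\near P, Y P = Z P) ->
  smooth_field_at Z P -> nabla P v Y = nabla P v Z.
Proof.
move=> YZ sZ; have D0 : \near P, Y P - Z P = 0.
  by apply: filterS YZ => Q ->; rewrite subrr.
have sD : smooth_field_at (fun Q => Y Q - Z Q) P.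
  apply: near_eq_smooth_field_at (smooth_field_at0 P).
  by apply: filterS D0.
have -> : Y = fun Q => Z Q + (Y Q - Z Q).
  by apply/funext => Q; rewrite addrC subrK.
by rewrite covD// (near0_cov v D0) addr0.
Qed.

Lemma cov_row_sum P v Y : smooth_field_at Y P ->
  nabla P v Y = \sum_j v 0 j *: nabla P (delta_mx 0 j) Y.
Proof.
move=> sY; apply: (linear_row_sum v (T := fun w => nabla P w Y)) => c u w.
exact: cov_linear.
Qed.

Lemma local_coord_field P k : \forall x \near chart_at P P,
  local_field (@id N) (coord_field P k) P x = delta_mx 0 k.
Proof.
have PP := mem_chart_at P.
apply: near_chart_at => //; apply: filterS (near_chart_dom PP) => Q PQ _.
rewrite /local_field /= chart_funK// chart_changeK//; exact: mem_chart_at.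
Qed.

Lemma smooth_coord_field P k : smooth_field_at (coord_field P k) P.
Proof.
apply: near_eq_smooth_at (smooth_at_cst (delta_mx 0 k) _).
by apply: filterS (local_coord_field P k).
Qed.

Lemma coord_field_self P k : coord_field P k P = delta_mx 0 k.
Proof. by rewrite /coord_field chart_change_id//; exact: mem_chart_at. Qed.

(** Coordinate fields are constant in their own chart, so their brackets
    vanish at the centre of that chart. *)
Lemma diff_local_coord_field P k v :
  'd (local_field (@id N) (coord_field P k) P) (chart_at P P) v = 0.
Proof.
have [_] : is_diff (chart_at P P) (local_field (@id N) (coord_field P k) P) 0.
  apply: near_eq_is_diff (is_diff_cst (delta_mx 0 k) _).
  by apply: filterS (local_coord_field P k).
by move=> /(congr1 (fun L => L v)).
Qed.

(** Symmetry of the Christoffel symbols, contracted with $v$ and $w$. *)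
Lemma cov_coord_sym P v w : torsion_free nabla ->
  \sum_k w 0 k *: nabla P v (coord_field P k)
  = \sum_k v 0 k *: nabla P w (coord_field P k).
Proof.
move=> tf.
have sym j k : nabla P (delta_mx 0 j) (coord_field P k)
    = nabla P (delta_mx 0 k) (coord_field P j).
  have := tf P _ _ (smooth_coord_field P j) (smooth_coord_field P k).
  rewrite !coord_field_self => E; apply/subr0_eq; apply: etrans E _.
  apply: etrans (congr2 (fun x y => x - y) (diff_local_coord_field _ _ _)
    (diff_local_coord_field _ _ _)) _.
  exact: subrr.
transitivity (\sum_k \sum_j (w 0 k * v 0 j) *:
    nabla P (delta_mx 0 j) (coord_field P k)).
  apply: eq_bigr => k _; rewrite (cov_row_sum v (smooth_coord_field P k)).
  by rewrite scaler_sumr; apply: eq_bigr => j _; rewrite scalerA.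
rewrite exchange_big; apply: eq_bigr => j _.
rewrite (cov_row_sum w (smooth_coord_field P j)) scaler_sumr.
by apply: eq_bigr => k _; rewrite scalerA mulrC sym.
Qed.

(** Locality, additivity and the Leibniz rule applied to the expansion of
    $Y$ in coordinate fields. The components of $Y$ in the fixed chart at $P$
    are the coefficient functions. *)
Lemma cov_coord P v Y : smooth_field_at Y P ->
  nabla P v Y = 'd (local_field (@id N) Y P) (chart_at P P) v
    + \sum_k Y P 0 k *: nabla P v (coord_field P k).
Proof.
move=> sY; have PP := mem_chart_at P.
set y := local_field (@id N) Y P.
pose h k Q := chart_change Q P Q (Y Q) 0 k.
have sh k : smooth_fun_at (h k) P.
  apply: (smooth_at_linear (L := @coord_lin R n k) _ sY).
  exact: (@coord_continuous _ _ _ 0 k).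
have hP k : h k P = Y P 0 k by rewrite /h chart_change_id.
have dh k : fun_deriv (h k) P v = ('d y (chart_at P P) v) 0 k.
  have dy := differentiableP (smooth_at_differentiable sY).
  have [_] := is_diff_comp dy (is_diff_coord k _).
  by move=> /(congr1 (fun L => L v)).
(* [covD] and [covZ] ask for smooth fields, so the expansion is built up one
   summand at a time, through partial sums whose smoothness is that of a linear
   image of the local expression of [Y]. *)
pose S (s : seq 'I_n) Q := \sum_(k <- s) h k Q *: coord_field P k Q.
have sS s : smooth_field_at (S s) P.
  pose Lf (u : 'rV[R]_n) : 'rV[R]_n := \sum_(k <- s) u 0 k *: delta_mx 0 k.
  have lin : linear Lf.
    move=> c u w; rewrite /Lf scaler_sumr -big_split; apply: eq_bigr => k _.
    by rewrite !mxE /= scalerDl scalerA.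
  pose lM := GRing.isLinear.Build _ _ _ _ Lf lin.
  pose L : {linear 'rV[R]_n -> 'rV[R]_n} := HB.pack Lf lM.
  have := smooth_at_linear (@linear_rV_continuous _ _ _ L) sY.
  apply: near_eq_smooth_at; apply: near_chart_at => //.
  apply: filterS (near_chart_dom PP) => Q PQ _.
  rewrite /local_field /= chart_funK// /L /= /Lf /S linear_sum.
  apply: eq_bigr => k _; rewrite linearZ /=; congr (_ *: _).
  by rewrite /coord_field chart_changeK//; exact: mem_chart_at.
have cS s : nabla P v (S s) = \sum_(k <- s) (fun_deriv (h k) P v *: delta_mx 0 k
    + Y P 0 k *: nabla P v (coord_field P k)).
  elim: s => [|k s IH].
    by rewrite big_nil; apply: near0_cov; near=> Q; rewrite /S big_nil.
  have s1 : smooth_field_at (fun Q => h k Q *: coord_field P k Q) P.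
    apply: near_eq_smooth_field_at (sS [:: k]); near=> Q.
    by rewrite /S big_seq1.
  have -> : S (k :: s) = fun Q => h k Q *: coord_field P k Q + S s Q.
    by apply/funext => Q; rewrite /S big_cons.
  rewrite big_cons covD// IH; congr (_ + _).
  rewrite covZ//; last exact: smooth_coord_field.
  by rewrite coord_field_self hP.
rewrite (near_eq_cov v _ (sS (index_enum _))).
  rewrite cS big_split; congr (_ + _).
  apply: etrans (esym (row_sum_delta _)).
  by apply: eq_bigr => k _; rewrite dh.
apply: filterS (near_chart_dom PP) => Q PQ.
rewrite /S /h -[LHS](chart_changeK (mem_chart_at Q) PQ).
rewrite [in LHS](row_sum_delta (chart_change Q P Q (Y Q))) linear_sum.
by apply: eq_bigr => k _; rewrite linearZ.
Unshelve. all: by end_near. Qed.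

End Connections.

(** * Orthogonal projection onto a submanifold *)

Section Metric.
Context {R : realType} {n : nat} {N : manifold R n}.
Variable g : riemannian_metric N.
Implicit Types (P : N) (u v w : 'rV[R]_n).

(** The metric with its second argument fixed, so that the theory of linear
    maps applies to the first one. *)
Definition metricl P w u : R := g P u w.
Fact metricl_is_linear P w : scalar (metricl P w).
Proof. by move=> c u v; exact: metric_linear. Qed.
HB.instance Definition _ P w :=
  GRing.isLinear.Build R 'rV[R]_n R *%R (metricl P w) (metricl_is_linear P w).

Lemma metricDl P u v w : g P (u + v) w = g P u w + g P v w.
Proof. exact: (linearD (metricl P w)). Qed.

Lemma metricBl P u v w : g P (u - v) w = g P u w - g P v w.
Proof. exact: (linearB (metricl P w)). Qed.

Lemma metricZl P c u w : g P (c *: u) w = c * g P u w.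
Proof. exact: (linearZ_LR (metricl P w)). Qed.

Lemma metric_suml P I (r : seq I) (F : I -> 'rV[R]_n) w :
  g P (\sum_(i <- r) F i) w = \sum_(i <- r) g P (F i) w.
Proof. exact: (linear_sum (metricl P w)). Qed.

Lemma metric_eq0 P u : g P u u = 0 -> u = 0.
Proof.
by move=> u0; apply/eqP/negP => /negP/(metric_gt0 g P); rewrite u0 ltxx.
Qed.

End Metric.

Section TangentialPart.
Context {R : realType} {m n : nat} {M : manifold R m} {N : manifold R n}.
Variables (g : riemannian_metric N) (f : M -> N) (p : M).
Hypothesis df_inj : injective (tangent_map f p).
Implicit Types (w : 'rV[R]_n).

Local Notation df := (tangent_map f p).

Definition normal_at w := forall v, g (f p) w (df v) = 0.

(** The Gram matrix of the pushed-forward coordinate basis is invertible: a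
    vector in its kernel pushes forward to a null vector, which is zero since
    the metric is definite and the differential injective. *)
Lemma tangential_part_exists w : exists u, normal_at (w - df u).
Proof.
pose G : 'M[R]_m :=
  \matrix_(i, j) g (f p) (df (delta_mx 0 i)) (df (delta_mx 0 j)).
have GE (u v : 'rV[R]_m) : g (f p) (df u) (df v) = (u *m G *m v^T) 0 0.
  rewrite mxE [in LHS](row_sum_delta v) metricC linear_sum metric_suml.
  apply: eq_bigr => j _; rewrite linearZ metricZl !mxE mulrC; congr (_ * _).
  rewrite metricC [in LHS](row_sum_delta u) linear_sum metric_suml.
  by apply: eq_bigr => i _; rewrite linearZ metricZl mxE.
have Gfree : row_free G.
  rewrite -kermx_eq0; apply/eqP/row_matrixP => i; rewrite row0.
  have : row i (kermx G) *m G = 0 by apply/sub_kermxP; exact: row_sub.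
  move: (row i _) => u uG; apply: df_inj; rewrite linear0.
  by apply: (@metric_eq0 _ _ _ g (f p)); rewrite GE uG mul0mx mxE.
have Gunit : G \in unitmx by rewrite -row_free_unit.
(* The normal equations, solved by the inverse Gram matrix. *)
exists ((\row_j g (f p) w (df (delta_mx 0 j))) *m invmx G) => v.
rewrite metricBl GE mulmxKV//; apply/eqP; rewrite subr_eq0; apply/eqP.
rewrite mxE [in LHS](row_sum_delta v) metricC linear_sum metric_suml.
by apply: eq_bigr => j _; rewrite linearZ metricZl !mxE mulrC metricC.
Qed.

Lemma tangential_partP w : normal_at (w - df (tangential_part g f p w)).
Proof. exact: (xgetPex 0 (tangential_part_exists w)). Qed.

Lemma tangential_part_eq w u :
  normal_at (w - df u) -> tangential_part g f p w = u.
Proof.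
move=> wu; apply: df_inj; apply/subr0_eq/(@metric_eq0 _ _ _ g (f p)).
rewrite -linearB [X in g _ X _](_ : _ = (w - df u)
  - (w - df (tangential_part g f p w))).
  by rewrite metricBl wu tangential_partP subrr.
by rewrite linearB opprB [RHS]addrC addrA subrK.
Qed.

Lemma tangential_partB w1 w2 :
  tangential_part g f p w1 - tangential_part g f p w2
  = tangential_part g f p (w1 - w2).
Proof.
apply/esym/tangential_part_eq => v.
rewrite linearB opprD addrACA -opprD metricBl.
by rewrite !tangential_partP subrr.
Qed.

Lemma tangential_part_eq0 w : tangential_part g f p w = 0 <-> normal_at w.
Proof.
split=> [w0 v|wn]; last by apply: tangential_part_eq; rewrite linear0 subr0.
by have := tangential_partP w v; rewrite w0 linear0 subr0.
Qed.

End TangentialPart.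

(** * Covariant derivatives along a map *)

Section CovariantDerivativeAlong.
Context {R : realType} {m n : nat} {M : manifold R m} {N : manifold R n}.
Variable f : M -> N.
Hypothesis sf : smooth_map f.
Implicit Types (nabla : connection N) (g : riemannian_metric N) (p : M).

(** By symmetry of the Christoffel symbols only the coordinate derivatives
    remain in the antisymmetrized covariant derivative. *)
Lemma cov_along_lie_bracket nabla p (X Y : M -> 'rV[R]_m) :
  torsion_free nabla -> smooth_field_at X p -> smooth_field_at Y p ->
  cov_along nabla f p (X p) (fun q => tangent_map f q (Y q))
  - cov_along nabla f p (Y p) (fun q => tangent_map f q (X q))
  = tangent_map f p (lie_bracket X Y p).
Proof.
move=> tf sX sY; rewrite /cov_along cov_coord_sym// opprD addrACA subrr addr0.
exact: tangent_lie_bracket.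
Qed.

(** Reduces $nabla_v (phi V)$ along $f$ to the ambient derivatives of the
    fields $phi d_k$, to which the Sasakian identities apply. *)
Lemma cov_along_endomorphism nabla (phi : N -> {linear 'rV[R]_n -> 'rV[R]_n})
    (V : M -> 'rV[R]_n) p v :
  (forall P X, smooth_field_at X P ->
    smooth_field_at (fun Q => phi Q (X Q)) P) ->
  differentiable (local_field f V p) (chart_at p p) ->
  cov_along nabla f p v (fun q => phi (f q) (V q))
  = phi (f p) ('d (local_field f V p) (chart_at p p) v)
    + \sum_k V p 0 k *: nabla (f p) (tangent_map f p v)
        (fun Q => phi Q (coord_field (f p) k Q)).
Proof.
move=> sphi dV; set P := f p; set w := tangent_map f p v.
have PP := mem_chart_at P.
have sphik k := sphi P _ (smooth_coord_field P k).
pose T Q u := chart_change Q P Q (phi Q u).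
have lT Q : linear (T Q) by move=> a x y; rewrite /T !linearP.
have [_ /(congr1 (fun L => L v)) /= dphiV] :=
  is_diff_tensor_along sf lT (differentiableP dV)
  (fun k => differentiableP (smooth_at_differentiable (sphik k))).
rewrite {1}/cov_along.
apply: etrans (congr1 (fun x => x + _) dphiV) _.
rewrite {1}/T chart_change_id// -addrA; congr (_ + _).
have -> : \sum_j phi (f p) (V p) 0 j *: nabla P w (coord_field P j)
    = \sum_k V p 0 k *: \sum_j phi P (delta_mx 0 k) 0 j *:
        nabla P w (coord_field P j).
  under [RHS]eq_bigr do rewrite scaler_sumr.
  rewrite exchange_big; apply: eq_bigr => j _.
  rewrite [in LHS](row_sum_delta (V p)) linear_sum summxE scaler_suml.
  by apply: eq_bigr => k _; rewrite linearZ !mxE scalerA.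
rewrite -big_split /=; apply: eq_bigr => k _; rewrite -scalerDr.
congr (_ *: _). apply/esym; apply: etrans (cov_coord nabla w (sphik k)) _.
by rewrite coord_field_self.
Qed.

(** Metric compatibility on the coordinate fields of the ambient manifold,
    carried to fields along $f$ by [is_diff_tensor_along]. *)
Lemma is_diff_metric_along g lc (Z : N -> 'rV[R]_n) (V : M -> 'rV[R]_n) p :
  levi_civita g lc -> smooth_field Z ->
  differentiable (local_field f V p) (chart_at p p) ->
  is_diff (chart_at p p)
    ((fun q => g (f q) (V q) (Z (f q))) \o chart_inv (chart_at p))
    (fun v => g (f p) (cov_along lc f p v V) (Z (f p))
      + g (f p) (V p) (lc (f p) (tangent_map f p v) Z)).
Proof.
move=> [_ lcg] sZ dV; set P := f p.
pose T Q u : R := g Q u (Z Q).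
have lT Q : linear (T Q) by move=> a x y; exact: metric_linear.
have dT k : is_diff (chart_at P P)
    (fun y => T (chart_inv (chart_at P) y)
      (coord_field P k (chart_inv (chart_at P) y)))
    (fun w => g P (lc P w (coord_field P k)) (Z P)
      + g P (delta_mx 0 k) (lc P w Z)).
  have sg := metric_smooth g (smooth_coord_field P k) (sZ P).
  apply: is_diff_eq (differentiableP (smooth_at_differentiable sg)) _.
  apply/funext => w; have := lcg P w _ _ (smooth_coord_field P k) (sZ P).
  rewrite /cov_metric coord_field_self => /eqP.
  by rewrite -addrA -opprD subr_eq0 => /eqP.
apply: is_diff_eq (is_diff_tensor_along sf lT (differentiableP dV) dT) _.
apply/funext => v; rewrite /cov_along metricDl -addrA; congr (_ + _).
rewrite metric_suml [in g P (V p) _](row_sum_delta (V p)) metric_suml.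
rewrite -big_split; apply: eq_bigr => k _.
by rewrite /= !metricZl -mulrDr.
Qed.

End CovariantDerivativeAlong.

(** * Sasakian statistical manifolds *)

Section Sasakian.
Context {R : realType} {m n : nat} {M : manifold R m} {N : manifold R n}.
Context {nabla lc : connection N} {g : riemannian_metric N}.
Context {phi : N -> {linear 'rV[R]_n -> 'rV[R]_n}}.
Context {xi : N -> 'rV[R]_n} {eta : N -> {scalar 'rV[R]_n}}.
Hypothesis ss : sasakian_statistical nabla g phi xi eta lc.

(** On the right, $2 hat nabla - nabla$ is the dual connection. The identity
    follows from $nabla (phi Y) = hat nabla (phi Y) - phi (K Y)$. *)
Lemma cov_phi P w Y : smooth_field_at Y P ->
  nabla P w (fun Q => phi Q (Y Q))
  = phi P (lc P w Y *+ 2 - nabla P w Y)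
    + (g P (Y P) (xi P) *: w - g P (Y P) w *: xi P).
Proof.
move=> sY; rewrite -(ss_lc_phi ss w sY).
have /eqP := ss_K_phi ss w sY; rewrite /difference_tensor.
rewrite addr_eq0 => /eqP/(canRL (subrK _)) ->.
have regroup (a b c : 'rV[R]_n) : b - a + c = b + b - a + (c - b).
  by rewrite -[b + b - a]addrA [RHS]addrC addrA subrK addrC.
by rewrite mulr2n !(linearB (phi P)) (linearD (phi P)) opprB.
Qed.

(** By [cov_along_endomorphism] the derivative of the components of $V$
    enters both sides through $phi$ alone; the remaining terms are combinations
    of [cov_phi] for the coordinate fields at $f p$. *)
Lemma cov_along_phi (f : M -> N) p v (V : M -> 'rV[R]_n) : smooth_map f ->
  differentiable (local_field f V p) (chart_at p p) ->
  cov_along nabla f p v (fun q => phi (f q) (V q))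
  = phi (f p) (cov_along lc f p v V *+ 2 - cov_along nabla f p v V)
    + (g (f p) (V p) (xi (f p)) *: tangent_map f p v
       - g (f p) (V p) (tangent_map f p v) *: xi (f p)).
Proof.
move=> sf dV; have sphi := acm_phi_smooth (ss_acm ss).
rewrite (cov_along_endomorphism sf nabla v sphi dV).
set P := f p; set w := tangent_map f p v; set dv := 'd _ _ v.
under eq_bigr do
  rewrite (cov_phi w (smooth_coord_field P _)) coord_field_self scalerDr.
rewrite big_split addrA; congr (_ + _).
  rewrite /cov_along -/P -/w -/dv.
  rewrite mulrnDl opprD addrACA mulr2n addrK linearD; congr (_ + _).
  rewrite -sumrMnl -sumrB linear_sum; apply: eq_bigr => k _.
  by rewrite scalerMnr -scalerBr linearZ.
rewrite [in g P (V p) (xi P)](row_sum_delta (V p)).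
rewrite [in g P (V p) w](row_sum_delta (V p)) !metric_suml !scaler_suml -sumrB.
by apply: eq_bigr => k _; rewrite !metricZl -!scalerA -scalerBr.
Qed.

End Sasakian.

(** * Contact CR-submanifolds *)

Section ContactCRSubmanifolds.
Context {R : realType} {m n : nat} {M : manifold R m} {N : manifold R n}.
Context {nabla lc : connection N} {g : riemannian_metric N}.
Context {phi : N -> {linear 'rV[R]_n -> 'rV[R]_n}}.
Context {xi : N -> 'rV[R]_n} {eta : N -> {scalar 'rV[R]_n}}.
Hypothesis ss : sasakian_statistical nabla g phi xi eta lc.
Context {f : M -> N} {D : M -> {vspace 'rV[R]_m}}.
Hypothesis ccr : contact_CR_submanifold g phi xi f D.
Implicit Types (p : M) (X Y : M -> 'rV[R]_m).

Local Notation Dperp := (orthogonal_distribution g f D).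

Let sf : smooth_map f.
Proof. by have [] := ccr_submanifold ccr. Qed.

Let df_inj p : injective (tangent_map f p).
Proof. by have [_ _] := ccr_submanifold ccr. Qed.

Lemma orthogonal_xi p v : Dperp p v ->
  g (f p) (tangent_map f p v) (xi (f p)) = 0.
Proof. by have [u uD <-] := ccr_xi ccr p; rewrite metricC; apply. Qed.

Let differentiable_along X p : smooth_field_at X p ->
  differentiable (local_field f (fun q => tangent_map f q (X q)) p)
    (chart_at p p).
Proof. by move=> sX; have [] := is_diff_local_field_tangent sf sX. Qed.

(** Differentiate $g(df Y, xi) = 0$: the other term is $g(df Y, phi (df
    v))$, and $phi (df v)$ is normal. *)
Lemma cov_along_xi p v Y : Dperp p v -> section_of Dperp Y ->
  g (f p) (cov_along lc f p v (fun q => tangent_map f q (Y q))) (xi (f p)) = 0.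
Proof.
move=> Dv [sY DY].
have [_] := is_diff_metric_along sf (ss_lc ss) (acm_xi_smooth (ss_acm ss))
  (differentiable_along (sY p)).
have -> : (fun q => g (f q) (tangent_map f q (Y q)) (xi (f q)))
    \o chart_inv (chart_at p) = cst 0.
  by apply/funext => x; exact: orthogonal_xi.
move=> /(etrans (esym (diff_cst _ _)))/(congr1 (fun L => L v)) /=.
rewrite (ss_lc_xi ss) [X in _ + X]metricC (ccr_anti_invariant ccr Dv) addr0.
by move<-.
Qed.

Lemma lie_bracket_xi p X Y : section_of Dperp X -> section_of Dperp Y ->
  g (f p) (tangent_map f p (lie_bracket X Y p)) (xi (f p)) = 0.
Proof.
move=> DX DY.
rewrite -(cov_along_lie_bracket sf (ss_lc ss).1 (DX.1 p) (DY.1 p)).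
by rewrite metricBl !cov_along_xi ?subrr//; [exact: DY.2|exact: DX.2].
Qed.

(** After antisymmetrizing [cov_along_phi] the metric terms cancel or
    vanish, and the torsion-free connections $hat nabla$ and $nabla$ leave $2 df
    [X, Y] - df [X, Y]$ under $phi$. *)
Lemma shape_operator_phi p X Y : section_of Dperp X -> section_of Dperp Y ->
  shape_operator nabla g f (fun q => phi (f q) (tangent_map f q (Y q))) p (X p)
  - shape_operator nabla g f
      (fun q => phi (f q) (tangent_map f q (X q))) p (Y p)
  = - tangential_part g f p
        (phi (f p) (tangent_map f p (lie_bracket X Y p))).
Proof.
move=> DX DY; rewrite /shape_operator -opprD.
rewrite tangential_partB; last exact: df_inj.
congr (- tangential_part g f p _).
rewrite (cov_along_phi ss _ sf (differentiable_along (DY.1 p))).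
rewrite (cov_along_phi ss _ sf (differentiable_along (DX.1 p))).
rewrite (orthogonal_xi (DX.2 p)) (orthogonal_xi (DY.2 p)) !scale0r !sub0r.
rewrite (metricC g _ (tangent_map f p (Y p))).
rewrite opprB addrA subrK -linearB; congr (phi _ _).
have swap (a b c d : 'rV[R]_n) : a - b - (c - d) = a - c - (b - d).
  by rewrite !opprD addrACA.
rewrite [LHS]swap -mulrnBl.
have bracket C (tf : torsion_free C) :=
  cov_along_lie_bracket sf tf (DX.1 p) (DY.1 p).
rewrite (bracket lc (ss_lc ss).1) (bracket nabla (ss_statistical ss).1).
by rewrite mulr2n addrK.
Qed.

(** The converse direction tests normality against the tangent vectors $phi
    (df u)$ with $u in D$, on which $phi$ is an isometry up to the
    $xi$-components; that of the bracket vanishes by [lie_bracket_xi]. *)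
Lemma phi_bracket_normal p X Y : section_of Dperp X -> section_of Dperp Y ->
  normal_at g f p (phi (f p) (tangent_map f p (lie_bracket X Y p)))
  <-> Dperp p (lie_bracket X Y p).
Proof.
move=> DX DY; split=> [nZ u uD|DZ w]; last exact: (ccr_anti_invariant ccr DZ).
have [w _ phiu] := ccr_invariant ccr uD.
have := nZ w; rewrite -phiu (acm_phi_metric (ss_acm ss)).
rewrite -!(acm_etaE (ss_acm ss)).
by rewrite lie_bracket_xi// mul0r subr0 metricC.
Qed.

End ContactCRSubmanifolds.

Theorem theorem3p6 (R : realType) (n m : nat)
  (Mbar : manifold R n) (nabla lc : connection Mbar)
  (g : riemannian_metric Mbar)
  (phi : Mbar -> {linear 'rV[R]_n -> 'rV[R]_n})
  (xi : Mbar -> 'rV[R]_n) (eta : Mbar -> {scalar 'rV[R]_n})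
  (hMbar : sasakian_statistical nabla g phi xi eta lc)
  (M : manifold R m) (f : M -> Mbar) (D : M -> {vspace 'rV[R]_m})
  (hM : contact_CR_submanifold g phi xi f D) :
  integrable_distribution (orthogonal_distribution g f D) <->
  (forall X Y : M -> 'rV[R]_m,
    section_of (orthogonal_distribution g f D) X ->
    section_of (orthogonal_distribution g f D) Y ->
    forall p : M,
      shape_operator nabla g f
        (fun q => phi (f q) (tangent_map f q (Y q))) p (X p)
      - shape_operator nabla g f
          (fun q => phi (f q) (tangent_map f q (X q))) p (Y p)
      = g (f p) (tangent_map f p (Y p)) (xi (f p)) *: X p
        - g (f p) (tangent_map f p (X p)) (xi (f p)) *: Y p).
Proof.
have df_inj p : injective (tangent_map f p).
  by have [_ _] := ccr_submanifold hM.
suff key X Y p : section_of (orthogonal_distribution g f D) X ->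
    section_of (orthogonal_distribution g f D) Y ->
    orthogonal_distribution g f D p (lie_bracket X Y p) <->
    shape_operator nabla g f
      (fun q => phi (f q) (tangent_map f q (Y q))) p (X p)
    - shape_operator nabla g f
        (fun q => phi (f q) (tangent_map f q (X q))) p (Y p)
    = g (f p) (tangent_map f p (Y p)) (xi (f p)) *: X p
      - g (f p) (tangent_map f p (X p)) (xi (f p)) *: Y p.
  by split=> [intD X Y DX DY p|eqA X Y DX DY p]; apply/key => //;
    [exact: intD|exact: eqA].
move=> DX DY; rewrite (shape_operator_phi hMbar hM p DX DY).
rewrite !(orthogonal_xi hM); [|exact: DX.2|exact: DY.2].
rewrite !scale0r subrr.
apply: iff_trans (iff_sym (phi_bracket_normal hMbar hM p DX DY)) _.
apply: iff_trans (iff_sym (tangential_part_eq0 g (df_inj p) _)) _.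
by split=> [->|/eqP]; [rewrite oppr0|rewrite oppr_eq0 => /eqP].
Qed.
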